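(* Let $n=6b$ or $n=12b$ or $n=24b$ where $b\geq 1$ and $\gcd(b,6)=1$, let $2\leq m<n$ and $m\equiv 2\bmod 6$. Let $\gamma_\rho$ be the last non-zero determinantal divisor of the $n\times n$ circulant matrix associated with $f(t)=t^m-t+1$. Then $\gamma_\rho=1$ if and only if $m=2$. (That is, $H(n,m)^{\mathrm{ab}}\cong\mathbb{Z}^2$ if and only if $m=2$, in which case $H(n,m)=H(n,2)$ is the Sieradski group $S(2,n)$.)
   Context: The $n\times n$ circulant matrix associated with $f\in\mathbb{Z}[t]$ is the circulant matrix whose first row is $(a_0,\ldots,a_{n-1})$, where $\sum_{i=0}^{n-1}a_it^i$ is the remainder of $f$ modulo $t^n-1$. If its Smith normal form is $\mathrm{diag}_n(s_1,\ldots,s_\rho,0,\ldots,0)$ with $\rho$ its rank, then the last non-zero determinantal divisor is $\gamma_\rho=\prod_{i=1}^\rho s_i$, taken positive. $H(n,m)$ (a Gilbert-Howie group) is the group $\langle x_0,\ldots,x_{n-1}\mid x_ix_{i+m}x_{i+1}^{-1}\ (0\leq i<n)\rangle$, subscripts taken modulo $n$; $S(2,n)=H(n,2)$. $G^{\mathrm{ab}}$ denotes the abelianisation of $G$. *)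

(* Defs.v *)
From HB Require Import structures.
From mathcomp Require Import all_boot all_order all_algebra.
From mathcomp Require Import boolp.

Set Implicit Arguments.
Unset Strict Implicit.
Unset Printing Implicit Defensive.

Import GRing.Theory.
Local Open Scope ring_scope.

(* The division is by a monic polynomial, hence an exact Euclidean division
   over int. *)
Definition circulant (n : nat) (f : {poly int}) : 'M[int]_n :=
  \matrix_(i, j) (f %% ('X^n - 1))`_((j + (n - i)) %% n)%N.

(* [s] lists the non-zero diagonal entries only, so that [size s] is the rank
   of [A] and the remaining diagonal entries are the default value 0 of
   [s`_i]. The signs of the entries are not normalised. *)
Definition is_smith_normal_form (n : nat) (A : 'M[int]_n) (s : seq int) : Prop :=
  [/\ (size s <= n)%N, all (fun x => x != 0) s, sorted dvdz s &
      exists L R : 'M[int]_n,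
        [/\ L \in unitmx, R \in unitmx &
            A = L *m (\matrix_(i, j) (s`_i *+ (i == j :> nat))) *m R]].

Definition is_last_determinantal_divisor
    (n : nat) (A : 'M[int]_n) (gamma : nat) : Prop :=
  exists2 s, is_smith_normal_form A s & gamma = absz (\prod_(x <- s) x).

Lemma dvdz_sorted_prefix (d : seq int) : sorted dvdz d ->
  exists2 k, forall i, (d`_i != 0) = (i < k)%N & (k <= size d)%N.
Proof.
elim: d => [|x d IH] /=; first by exists 0%N => // i; rewrite nth_nil eqxx.
move=> xd; have [k Hk kd] := IH (path_sorted xd).
case: (eqVneq x 0) xd => [-> xd|x0 _].
  exists 0%N => // i; apply/negbF; case: i => //= i.
  have /allP h : all (dvdz 0) d.
    by move: xd; rewrite path_sortedE; [case/andP|exact: dvdz_trans].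
  case: (ltnP i (size d)) => [id|id]; last by rewrite nth_default.
  have : (0 %| d`_i)%Z by exact: h _ (mem_nth 0 id).
  by rewrite dvd0z => ->.
by exists k.+1 => // -[|i] /=; rewrite ?x0 // Hk.
Qed.

Lemma smith_normal_form_exists (n : nat) (A : 'M[int]_n) :
  exists s, is_smith_normal_form A s.
Proof.
have [L uL [R uR [d sd ->]]] := int_Smith_normal_form A.
have [k Hk kd] := dvdz_sorted_prefix sd.
have st : size (take (minn k n) d) = minn k n.
  by rewrite size_takel // geq_min kd.
exists (take (minn k n) d); split.
- by rewrite st geq_minr.
- apply/(all_nthP 0) => i; rewrite st => ik.
  by rewrite nth_take // Hk (leq_trans ik) // geq_minl.
- by apply: take_sorted.
exists L, R; split=> //; congr (_ *m _ *m _); apply/matrixP => i j; rewrite !mxE.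
congr (_ *+ _); case: (ltnP i (minn k n)) => ik; first by rewrite nth_take.
rewrite [RHS]nth_default ?st //; apply/eqP/negbNE; rewrite Hk -leqNgt.
by move: ik; rewrite geq_min [(n <= i)%N]leqNgt ltn_ord orbF.
Qed.

Lemma last_determinantal_divisor_exists (n : nat) (A : 'M[int]_n) :
  exists gamma, is_last_determinantal_divisor A gamma.
Proof.
have [s sA] := smith_normal_form_exists A.
by exists (absz (\prod_(x <- s) x)), s.
Qed.

Local Open Scope group_scope.
Local Open Scope quotient_scope.

Section FreeGroup.
Variable X : choiceType.

(* The letter (x, true) stands for x and (x, false) for its inverse. *)
Definition word : Type := seq (X * bool).
HB.instance Definition _ := Choice.on word.

Definition word_inv (u : word) : word := rev [seq (l.1, ~~ l.2) | l <- u].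

Inductive free_eq : word -> word -> Prop :=
| free_eq_cancel u v x b : free_eq (u ++ (x, b) :: (x, ~~ b) :: v) (u ++ v)
| free_eq_refl u : free_eq u u
| free_eq_sym u v : free_eq u v -> free_eq v u
| free_eq_trans u v w : free_eq u v -> free_eq v w -> free_eq u w.

Definition free_eqb (u v : word) : bool := `[< free_eq u v >].

Lemma free_eqb_refl : reflexive free_eqb.
Proof. by move=> u; apply/asboolP/free_eq_refl. Qed.

Lemma free_eqb_sym : symmetric free_eqb.
Proof. by move=> u v; apply/asboolP/asboolP => /free_eq_sym. Qed.

Lemma free_eqb_trans : transitive free_eqb.
Proof. by move=> v u w /asboolP uv /asboolP /(free_eq_trans uv) /asboolP. Qed.

Canonical free_equiv : equiv_rel word :=
  EquivRel free_eqb free_eqb_refl free_eqb_sym free_eqb_trans.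

Definition free_group : Type := {eq_quot free_equiv}.
HB.instance Definition _ := Choice.on free_group.
HB.instance Definition _ := EqQuotient.on free_group.

Lemma free_piP u v : \pi_free_group u = \pi_free_group v <-> free_eq u v.
Proof.
split=> [/eqP|uv]; first by rewrite (pi_eq_quot (s := free_group)) => /asboolP.
by apply/eqP; rewrite (pi_eq_quot (s := free_group)); apply/asboolP.
Qed.

Lemma free_eq_catl w u v : free_eq u v -> free_eq (w ++ u) (w ++ v).
Proof.
elim=> {u v} [u v x b|u|u v _|u v t _ uv _].
- by rewrite !catA; exact: free_eq_cancel.
- exact: free_eq_refl.
- exact: free_eq_sym.
- exact: free_eq_trans.
Qed.

Lemma free_eq_catr w u v : free_eq u v -> free_eq (u ++ w) (v ++ w).
Proof.
elim=> {u v} [u v x b|u|u v _|u v t _ uv _].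
- by rewrite -!catA; exact: free_eq_cancel.
- exact: free_eq_refl.
- exact: free_eq_sym.
- exact: free_eq_trans.
Qed.

Lemma free_eq_inv u v : free_eq u v -> free_eq (word_inv u) (word_inv v).
Proof.
elim=> {u v} [u v x b|u|u v _|u v t _ uv _].
- rewrite /word_inv !map_cat /= !rev_cat !rev_cons -!cats1 -!catA /= negbK.
  exact: free_eq_cancel.
- exact: free_eq_refl.
- exact: free_eq_sym.
- exact: free_eq_trans.
Qed.

Lemma word_invK : involutive word_inv.
Proof.
move=> u; rewrite /word_inv map_rev revK -map_comp map_id_in // => -[x b] _ /=.
by rewrite negbK.
Qed.

Lemma free_eq_mulV u : free_eq (u ++ word_inv u) [::].
Proof.
elim: u => [|[x b] u IH]; first exact: free_eq_refl.
rewrite /word_inv /= rev_cons -cats1 -/(word_inv u) catA.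
apply: (@free_eq_trans _ ([:: (x, b)] ++ [:: (x, ~~ b)])).
  exact: (free_eq_catl [:: (x, b)] (free_eq_catr [:: (x, ~~ b)] IH)).
exact: (free_eq_cancel [::] [::]).
Qed.

Definition free_one : free_group := \pi_free_group ([::] : word).
Definition free_mul (a b : free_group) : free_group :=
  \pi_free_group (repr a ++ repr b : word).
Definition free_inv (a : free_group) : free_group :=
  \pi_free_group (word_inv (repr a)).

Lemma free_reprP u : free_eq (repr (\pi_free_group u)) u.
Proof. by apply/free_piP; rewrite reprK. Qed.

Lemma free_mulE u v :
  free_mul (\pi_free_group u) (\pi_free_group v) = \pi_free_group (u ++ v).
Proof.
apply/free_piP; apply: free_eq_trans (free_eq_catr v (free_reprP u)).
exact: free_eq_catl (free_reprP v).
Qed.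

Lemma free_invE u : free_inv (\pi_free_group u) = \pi_free_group (word_inv u).
Proof. exact/free_piP/free_eq_inv/free_reprP. Qed.

Lemma free_mulA : associative free_mul.
Proof.
elim/quotW=> a; elim/quotW=> b; elim/quotW=> c.
by rewrite (free_mulE a b) (free_mulE b c) !free_mulE catA.
Qed.

Lemma free_mul1 : left_id free_one free_mul.
Proof. by elim/quotW=> a; rewrite free_mulE. Qed.

Lemma free_mulr1 : right_id free_one free_mul.
Proof. by elim/quotW=> a; rewrite free_mulE cats0. Qed.

Lemma free_mulrV : right_inverse free_one free_inv free_mul.
Proof.
elim/quotW=> a; rewrite free_invE free_mulE.
exact/free_piP/free_eq_mulV.
Qed.

Lemma free_mulV : left_inverse free_one free_inv free_mul.
Proof.
elim/quotW=> a; rewrite free_invE free_mulE; apply/free_piP.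
by rewrite -{2}[a]word_invK; exact: free_eq_mulV.
Qed.

HB.instance Definition _ := isGroup.Build free_group
  free_mulA free_mul1 free_mulr1 free_mulV free_mulrV.

Definition free_gen (x : X) : free_group := \pi_free_group ([:: (x, true)] : word).

End FreeGroup.

Section QuotientGroup.
Variables (G : groupType) (S : G -> Prop).
Implicit Types x y z : G.

Inductive normal_closure : G -> Prop :=
| normal_closure1 : normal_closure 1
| normal_closure_gen x : S x -> normal_closure x
| normal_closureM x y :
    normal_closure x -> normal_closure y -> normal_closure (x * y)
| normal_closureV x : normal_closure x -> normal_closure x^-1
| normal_closureJ x y : normal_closure x -> normal_closure (x ^ y).

Definition coset_eqb x y : bool := `[< normal_closure (x^-1 * y) >].

Lemma coset_eqb_refl : reflexive coset_eqb.
Proof. by move=> x; apply/asboolP; rewrite mulVg; exact: normal_closure1. Qed.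

Lemma coset_eqb_sym : symmetric coset_eqb.
Proof.
by move=> x y; apply/asboolP/asboolP => /normal_closureV; rewrite invgM invgK.
Qed.

Lemma coset_eqb_trans : transitive coset_eqb.
Proof.
move=> y x z /asboolP xy /asboolP yz; apply/asboolP.
by have := normal_closureM xy yz; rewrite mulgA mulgK.
Qed.

Canonical coset_equiv : equiv_rel G :=
  EquivRel coset_eqb coset_eqb_refl coset_eqb_sym coset_eqb_trans.

(* The quotient of G by the normal closure of S. *)
Definition quotient_group : Type := {eq_quot coset_equiv}.
HB.instance Definition _ := Choice.on quotient_group.
HB.instance Definition _ := EqQuotient.on quotient_group.

Lemma quotient_piP x y :
  \pi_quotient_group x = \pi_quotient_group y <-> normal_closure (x^-1 * y).
Proof.
split=> [/eqP|xy].
  by rewrite (pi_eq_quot (s := quotient_group)) => /asboolP.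
by apply/eqP; rewrite (pi_eq_quot (s := quotient_group)); apply/asboolP.
Qed.

Definition quotient_one : quotient_group := \pi_quotient_group (1 : G).
Definition quotient_mul (a b : quotient_group) : quotient_group :=
  \pi_quotient_group (repr a * repr b : G).
Definition quotient_inv (a : quotient_group) : quotient_group :=
  \pi_quotient_group ((repr a)^-1 : G).

Lemma quotient_reprP x : normal_closure ((repr (\pi_quotient_group x))^-1 * x).
Proof. by apply/quotient_piP; rewrite reprK. Qed.

Lemma quotient_mulE x y :
  quotient_mul (\pi_quotient_group x) (\pi_quotient_group y)
  = \pi_quotient_group (x * y).
Proof.
apply/quotient_piP; set x' := repr _; set y' := repr _.
have -> : (x' * y')^-1 * (x * y) = ((x'^-1 * x) ^ y') * (y'^-1 * y).
  by rewrite /conjg invgM !mulgA mulgK.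
by apply: normal_closureM; [apply: normal_closureJ|]; exact: quotient_reprP.
Qed.

Lemma quotient_invE x :
  quotient_inv (\pi_quotient_group x) = \pi_quotient_group x^-1.
Proof.
apply/quotient_piP; set x' := repr _.
have -> : x'^-1^-1 * x^-1 = ((x'^-1 * x)^-1) ^ x'^-1.
  by rewrite /conjg invgM !invgK !mulgA mulgK.
by apply/normal_closureJ/normal_closureV; exact: quotient_reprP.
Qed.

Lemma quotient_mulA : associative quotient_mul.
Proof.
elim/quotW=> a; elim/quotW=> b; elim/quotW=> c.
by rewrite (quotient_mulE a b) (quotient_mulE b c) !quotient_mulE mulgA.
Qed.

Lemma quotient_mul1 : left_id quotient_one quotient_mul.
Proof. by elim/quotW=> a; rewrite quotient_mulE mul1g. Qed.

Lemma quotient_mulr1 : right_id quotient_one quotient_mul.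
Proof. by elim/quotW=> a; rewrite quotient_mulE mulg1. Qed.

Lemma quotient_mulV : left_inverse quotient_one quotient_inv quotient_mul.
Proof. by elim/quotW=> a; rewrite quotient_invE quotient_mulE mulVg. Qed.

Lemma quotient_mulrV : right_inverse quotient_one quotient_inv quotient_mul.
Proof. by elim/quotW=> a; rewrite quotient_invE quotient_mulE mulgV. Qed.

HB.instance Definition _ := isGroup.Build quotient_group
  quotient_mulA quotient_mul1 quotient_mulr1 quotient_mulV quotient_mulrV.

End QuotientGroup.

Definition presented_group (X : choiceType) (R : free_group X -> Prop) :
    groupType :=
  quotient_group R.

(* A conjugate of a commutator is a commutator, so the normal closure is the
   commutator subgroup of G. *)
Definition abelianisation (G : groupType) : groupType :=
  quotient_group (fun z : G => exists x y : G, z = [~ x, y]).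

Definition isomorphic_to_additive (G : groupType) (V : zmodType) : Prop :=
  exists f : G -> V, bijective f /\ forall x y : G, f (x * y) = (f x + f y)%R.

Definition ord_shift (n : nat) (i : 'I_n) (k : nat) : 'I_n :=
  Ordinal (ltn_pmod (i + k) (leq_ltn_trans (leq0n i) (ltn_ord i))).

Definition gilbert_howie_relator (n m : nat) (r : free_group 'I_n) : Prop :=
  exists i : 'I_n,
    r = free_gen i * free_gen (ord_shift i m) * (free_gen (ord_shift i 1))^-1.

Definition gilbert_howie (n m : nat) : groupType :=
  presented_group (@gilbert_howie_relator n m).

Definition sieradski (n : nat) : groupType := gilbert_howie n 2.

(* Main.v *)
Require Import Defs.
From HB Require Import structures.
From mathcomp Require Import all_boot all_order all_algebra.
From mathcomp Require Import perm generic_quotient ring zify.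

(* Write Phi = t^2 - t + 1 and f = t^m - t + 1. As m = 2 mod 6, f = F Phi, and
   t^n - 1 = G Phi since 6 | n. The circulant matrix C of f is f(P), P the
   cyclic shift. It is normal, which forces ker C = ker Phi(P); hence c Phi lies
   in the ideal (f, t^n - 1) for c the product of the invariant factors, and
   either of the conditions (c = 1 up to sign, or torsion-freeness of the
   abelianisation, which is Z[t]/(f, t^n - 1)) puts Phi itself in that ideal.
   Cancelling Phi, F is a unit modulo G, hence modulo t^d - 1 with d = n/3, a
   divisor of G because d is even and prime to 3. Now if u is a unit of
   Z[t]/(t^d - 1) and u* its image under t -> t^-1, then u/u* = a satisfies
   a a* = 1, so the squares of its integer coefficients sum to 1 and a is, up
   to sign, a power of t. So f = t^k f* modulo t^d - 1 for some k, and comparing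
   the six monomials gives m = 1 or m = 2 mod d. By parity m = 2 mod d, so
   m = 2.
   Conversely, for m = 2 everything follows from Z[t]/(Phi) being free of
   rank 2. *)

Set Implicit Arguments.
Unset Strict Implicit.
Unset Printing Implicit Defensive.

Import Order.TTheory GRing.Theory Num.Theory.
Import Pdiv.Idomain Pdiv.IdomainMonic.
Local Open Scope ring_scope.

(** * The cyclic shift matrix *)

Section Shift.
Variable n : nat.
Local Notation N := n.+1.
Local Notation cyc := ('X^N - 1 : {poly int}).

Lemma ord_shift_inj : injective (fun i : 'I_N => ord_shift i 1).
Proof.
move=> i j /(congr1 val) /= /eqP; rewrite eqn_modDr !modn_small // => /eqP ij.
exact: val_inj.
Qed.

Definition shift_mx : 'M[int]_N := perm_mx (perm ord_shift_inj).
Local Notation P := shift_mx.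
Local Notation ev := (horner_mx P).

Lemma shift_mxXE k (i j : 'I_N) : (P ^+ k) i j = (j == ord_shift i k)%:R.
Proof.
have -> : P ^+ k = perm_mx (perm ord_shift_inj ^+ k)%g.
  elim: k => [|k IHk]; first by rewrite expr0 expg0 perm_mx1.
  by rewrite exprSr IHk expgSr perm_mxM.
rewrite !mxE permX eq_sym; congr (_ == _)%:R.
elim: k => [|k IHk] /=.
  by apply: val_inj; rewrite /= addn0 modn_small.
by rewrite IHk permE; apply: val_inj; rewrite /= modnDml addn1 addnS.
Qed.

Lemma shift_mx_tr : P^T *m P = 1%:M.
Proof. by rewrite tr_perm_mx -perm_mxM mulVg perm_mx1. Qed.

Lemma shift_mx_trr : P *m P^T = 1%:M.
Proof. by rewrite tr_perm_mx -perm_mxM mulgV perm_mx1. Qed.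

Lemma shift_mxXN : P ^+ N = 1.
Proof.
apply/matrixP=> i j; rewrite shift_mxXE mxE eq_sym; congr ((_ == _)%:R).
by apply: val_inj; rewrite /= modnDr modn_small.
Qed.

Lemma cyc_monic : cyc \is monic.
Proof. exact: monicXnsubC. Qed.

Lemma size_cyc : size cyc = n.+2.
Proof. exact: size_XnsubC. Qed.

Lemma ev_mod q : ev (q %% cyc) = ev q.
Proof.
rewrite [in RHS](divp_eq cyc_monic q) rmorphD rmorphM /= rmorphB rmorphXn /=.
by rewrite horner_mx_X rmorph1 shift_mxXN subrr mulr0 add0r.
Qed.

Lemma size_mod_cyc q : (size (q %% cyc)%R <= N)%N.
Proof. by rewrite -ltnS -size_cyc ltn_modp monic_neq0 // cyc_monic. Qed.

(** Reduced modulo t^N - 1, [q] is a combination of the t^k with k < N, and only k = j - i modulo N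
    contributes to the entry (i, j). *)
Lemma ev_entry q (i j : 'I_N) :
  ev q i j = (q %% cyc)`_((j + (N - i)) %% N).
Proof.
rewrite -ev_mod; set r := q %% cyc.
have -> : r = \poly_(k < N) r`_k.
  apply/polyP=> k; rewrite coef_poly; case: ltnP => // le_Nk.
  by rewrite nth_default // (leq_trans (size_mod_cyc q)).
rewrite coef_poly ltn_pmod // poly_def rmorph_sum summxE /=.
pose k0 : 'I_N := Ordinal (ltn_pmod (j + (N - i)) (ltn0Sn n)).
rewrite (bigD1 k0) //= big1 => [|k kk0].
  rewrite addr0 linearZ /= rmorphXn /= horner_mx_X mxE shift_mxXE.
  suff -> : j == ord_shift i k0 by rewrite mulr1.
  apply/eqP/val_inj; rewrite /= modnDmr addnCA subnKC 1?ltnW // modnDr.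
  by rewrite modn_small.
rewrite linearZ /= rmorphXn /= horner_mx_X mxE shift_mxXE.
case: eqP => [jE|]; last by rewrite mulr0.
case/eqP: kk0; apply: val_inj; rewrite /= jE /= modnDml addnAC subnKC 1?ltnW //.
by rewrite modnDl modn_small.
Qed.

Lemma circulant_ev q : circulant N q = ev q.
Proof. by apply/matrixP=> i j; rewrite ev_entry mxE. Qed.

Lemma ev_row0 q : row 0 (ev q) = poly_rV (q %% cyc).
Proof.
by apply/rowP=> j; rewrite !mxE ev_entry subn0 modnDr modn_small.
Qed.

(** Row 0 lists the coefficients of the remainder, so it alone determines the class of [q] modulo
    t^N - 1. *)
Lemma ev_eq0 q : row 0 (ev q) = 0 -> exists h, q = h * cyc.
Proof.
rewrite ev_row0 => /(congr1 rVpoly); rewrite poly_rV_K ?size_mod_cyc // linear0.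
by move=> q0; exists (q %/ cyc); rewrite {1}(divp_eq cyc_monic q) q0 addr0.
Qed.

Lemma ev_cyc h : ev (h * cyc) = 0.
Proof.
rewrite rmorphM rmorphB rmorphXn /= horner_mx_X rmorph1 shift_mxXN.
by rewrite subrr mulr0.
Qed.

(** The transpose of P is its inverse P^n, so transposing realises t -> t^-1. *)
Lemma ev_tr q : (ev q)^T = ev (q \Po 'X^n).
Proof.
have PT : P^T = P ^+ n :> 'M_N.
  by rewrite -[LHS]mulmx1 -[1%:M]shift_mxXN exprS mulmxA shift_mx_tr mul1mx.
elim/poly_ind: q => [|q c IHq]; first by rewrite comp_poly0 !rmorph0 trmx0.
rewrite comp_poly_MXaddC !rmorphD !rmorphM /= rmorphXn /= linearD /= trmx_mul.
rewrite !horner_mx_C !horner_mx_X tr_scalar_mx IHq PT; congr (_ + _).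
by have := comm_horner_mx2 P 'X^n (q \Po 'X^n); rewrite rmorphXn /= horner_mx_X.
Qed.

Lemma ev_comm p q : ev p *m ev q = ev q *m ev p.
Proof. exact: comm_horner_mx2. Qed.

Lemma ev_tr_comm p q : ev p *m (ev q)^T = (ev q)^T *m ev p.
Proof. by rewrite ev_tr ev_comm. Qed.

End Shift.

(** * Kernels of normal integer matrices *)

Lemma mulmx_tr_diag_eq0 m n (A : 'M[int]_(m, n)) : A^T *m A = 0 -> A = 0.
Proof.
move=> /matrixP A0; apply/matrixP=> i j; rewrite mxE.
have := A0 j j; rewrite !mxE => /eqP.
under eq_bigr do rewrite mxE -expr2.
by rewrite psumr_eq0 => [|k _]; rewrite ?sqr_ge0 // => /allP /(_ i);
  rewrite mem_index_enum sqrf_eq0 => /(_ isT) /eqP.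
Qed.

(** For B = A^T M, normality gives B^T B = M^T A^T A M = 0, and the diagonal of B^T B holds the sums
    of squares of the columns of B. *)
Lemma normal_mx_ker n m (A : 'M[int]_n) (M : 'M_(n, m)) :
  A *m A^T = A^T *m A -> A *m M = 0 -> A^T *m M = 0.
Proof.
move=> nA AM; apply: mulmx_tr_diag_eq0.
by rewrite trmx_mul trmxK -mulmxA (mulmxA A) nA -mulmxA AM !mulmx0.
Qed.

Local Notation Phi6 := ('X^2 - 'X + 1 : {poly int}).
Local Notation fpoly m := ('X^m - 'X + 1 : {poly int}).

(* Over a root x of f of modulus 1, x^m = x - 1 and its conjugate
   x^-m = x^-1 - 1 multiply to x^2 - x + 1 = 0. *)
Lemma fpoly_ker n m (M : 'M[int]_n.+1) :
  horner_mx (shift_mx n) (fpoly m) *m M = 0 ->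
  horner_mx (shift_mx n) Phi6 *m M = 0.
Proof.
set P := shift_mx n; set ev := horner_mx P => fM.
have fTM : (ev (fpoly m))^T *m M = 0
  by apply: normal_mx_ker fM; exact: ev_tr_comm.
pose Q : 'M[int]_n.+1 := P^T.
have PQ : P * Q = 1 by exact: shift_mx_trr.
have QP : Q * P = 1 by exact: shift_mx_tr.
have evE k : ev (fpoly k) = P ^+ k - P + 1.
  by rewrite /ev rmorphD rmorphB rmorphXn /= horner_mx_X rmorph1.
have trX k : (P ^+ k)^T = Q ^+ k.
  elim: k => [|k IHk]; first by rewrite !expr0 trmx1.
  by rewrite exprSr exprS -!mulmxE trmx_mul IHk.
have {fM} fM : P ^+ m * M = P * M - M.
  apply/eqP; rewrite -subr_eq0; apply/eqP; rewrite -{}[RHS]fM evE.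
  by change (P ^+ m * M - (P * M - M) = (P ^+ m - P + 1) * M);
    rewrite mulrDl mulrBl mul1r opprB addrA addrAC.
have {fTM} fTM : Q ^+ m * M = Q * M - M.
  apply/eqP; rewrite -subr_eq0; apply/eqP; rewrite -{}[RHS]fTM evE.
  have -> : (P ^+ m - P + 1)^T = Q ^+ m - Q + 1.
    by rewrite linearD linearB /= trX trmx1.
  by change (Q ^+ m * M - (Q * M - M) = (Q ^+ m - Q + 1) * M);
    rewrite mulrDl mulrBl mul1r opprB addrA addrAC.
have QPm : Q ^+ m * P ^+ m = 1.
  by rewrite -exprMn_comm ?QP ?expr1n // /GRing.comm PQ QP.
have cPQ : GRing.comm (Q ^+ m) P.
  by apply: commr_sym; apply: commrX; rewrite /GRing.comm PQ QP.
(* Apply Q^m to P^m M = P M - M; it inverts P^m and commutes with P. One more factor P then clears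
   Q. *)
have : M = P * (Q * M - M) - (Q * M - M).
  by rewrite -fTM mulrA -cPQ -mulrA -mulrBr -fM mulrA QPm mul1r.
rewrite mulrBr mulrA PQ mul1r => /(congr1 (fun X => P * X)).
rewrite !mulrBr (mulrA P Q) PQ mul1r evE -addrA => /eqP.
rewrite -[X in X == _]addr0 (inj_eq (addrI _)) => /eqP/esym e.
change ((P ^+ 2 - P + 1) * M = 0).
rewrite -[RHS]oppr0 -e opprD !opprK mulrDl mulrBl mul1r expr2 -mulrA.
by rewrite addrAC addrA.
Qed.

(** * Smith normal forms of circulant matrices *)

Section CirculantRows.
Variable n : nat.
Local Notation N := n.+1.
Local Notation cyc := ('X^N - 1 : {poly int}).
Local Notation ev := (horner_mx (shift_mx n)).

Lemma row0_ev_rVpoly (v : 'rV[int]_N) : row 0 (ev (rVpoly v)) = v.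
Proof.
rewrite ev_row0 modp_small ?rVpolyK // size_cyc ltnS.
exact: leq_trans (size_poly _ _) _.
Qed.

Lemma row0_evM p q : row 0 (ev p) *m ev q = row 0 (ev (p * q)).
Proof. by rewrite rmorphM -row_mul. Qed.

(** Under [rVpoly], a row times a circulant matrix is a product in Z[t]/(t^N - 1). *)
Lemma mulmx_ev (v : 'rV[int]_N) q : v *m ev q = row 0 (ev (rVpoly v * q)).
Proof. by rewrite -row0_evM row0_ev_rVpoly. Qed.

Lemma row0_ev_inj p q : row 0 (ev p) = row 0 (ev q) ->
  exists h, p = q + h * cyc.
Proof.
move=> pq; have [|h /eqP] := @ev_eq0 n (p - q).
  by rewrite rmorphB linearB /= pq subrr.
by rewrite subr_eq addrC => /eqP ->; exists h.
Qed.

Lemma row0_ev_cyc p h : row 0 (ev (p + h * cyc)) = row 0 (ev p).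
Proof. by rewrite rmorphD /= ev_cyc addr0. Qed.

End CirculantRows.

Definition smith_mx n (s : seq int) : 'M[int]_n :=
  \matrix_(i, j) (s`_i *+ (i == j :> nat)).

Lemma smith_mxE n s : smith_mx n s = diag_mx (\row_i s`_i).
Proof. by apply/matrixP=> i j; rewrite !mxE. Qed.

(** Take for D the diagonal matrix of the quotients c / s_i, integers because s_i divides the
    product c; beyond [size s] both sides vanish. *)
Lemma smith_mx_pinv n (s : seq int) (c := \prod_(x <- s) x) :
  exists D : 'M[int]_n, smith_mx n s *m D *m smith_mx n s = c *: smith_mx n s.
Proof.
exists (diag_mx (\row_i (c %/ s`_i)%Z)); rewrite !smith_mxE !mulmx_diag.
rewrite -linearZ; congr diag_mx; apply/rowP=> i; rewrite !mxE.
have [lt_is|le_si] := ltnP i (size s); last by rewrite nth_default // !mulr0.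
congr (_ * _); rewrite mulrC divzK //.
rewrite /c (big_nth 0) big_mkord (bigD1 (Ordinal lt_is)) //=.
exact: dvdz_mulr.
Qed.

(** X = R^-1 D L^-1 satisfies C X C = c C, so C annihilates X C - c, and by [fpoly_ker] so does
    Phi(P). Row 0 of the resulting equation is the claim. *)
Lemma fpoly_snf_Phi6 n m s (c := \prod_(x <- s) x) :
  is_smith_normal_form (circulant n.+1 (fpoly m)) s ->
  exists g h : {poly int}, c *: Phi6 = g * fpoly m + h * ('X^(n.+1) - 1).
Proof.
case=> _ _ _ [L [R [uL uR]]]; rewrite circulant_ev -/(smith_mx _ s).
set ev := horner_mx _ => defC; set C := ev _ in defC.
have [D DD] := smith_mx_pinv n.+1 s.
pose X := invmx R *m D *m invmx L.
have CXC : C *m X *m C = c *: C.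
  rewrite defC /X !mulmxA mulmxK // mulmxKV //.
  by rewrite -(mulmxA L _ D) -(mulmxA L (_ *m D)) DD -scalemxAr -scalemxAl.
have /fpoly_ker : C *m (X *m C - c%:M) = 0.
  by rewrite mulmxBr mulmxA CXC -scalemx1 -scalemxAr mulmx1 subrr.
rewrite -/ev mulmxBr mulmxA mul_mx_scalar => /eqP; rewrite subr_eq0 => /eqP.
move/(congr1 (row 0)); rewrite row_mul mulmx_ev -linearZ /= => /esym.
by case/row0_ev_inj=> h ->; exists (rVpoly (row 0 (ev Phi6 *m X))), h.
Qed.

Lemma Phi6_monic : Phi6 \is monic.
Proof.
rewrite monicE -addrA lead_coefDl ?lead_coefXn // size_polyXn.
by rewrite (leq_ltn_trans (size_polyD _ _)) // size_polyN size_polyX size_poly1.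
Qed.

(** Z[t]/(Phi) is torsion-free: Phi is monic, so reduction modulo Phi commutes with scaling by c. *)
Lemma Phi6_sat (c : int) (p k : {poly int}) : c != 0 -> c *: p = k * Phi6 ->
  exists g, p = g * Phi6.
Proof.
move=> c0 /(congr1 (fun q => q %% Phi6)); rewrite modp_mull.
rewrite Pdiv.IdomainUnit.modpZl ?(eqP Phi6_monic) ?unitr1 // => /eqP.
rewrite -mul_polyC mulf_eq0 polyC_eq0 (negPf c0) /= => /eqP p0.
by exists (p %/ Phi6); rewrite {1}(divp_eq Phi6_monic p) p0 addr0.
Qed.

Lemma subX1_dvd (R : comNzRingType) (x : R) a b :
  exists q, x ^+ (a * b) - 1 = q * (x ^+ a - 1).
Proof. by rewrite exprM subrX1 mulrC; eexists. Qed.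

Lemma Phi6_dvd b : exists q : {poly int}, 'X^(6 * b) - 1 = q * Phi6.
Proof.
have [q ->] := subX1_dvd ('X : {poly int}) 6 b.
by exists (q * ('X + 1) * ('X^3 - 1)); ring.
Qed.

(** If x is the entry of index i and e the unit row i, then x (e R) lies in the row lattice of the
    circulant, that is, among the multiples of Phi. By [Phi6_sat] so does e R; hence e is an integer
    combination of the rows of the diagonal matrix, and x divides 1. *)
Lemma Phi6_snf_unit n b s : n.+1 = (6 * b)%N ->
  is_smith_normal_form (circulant n.+1 Phi6) s ->
  {in s, forall x, `|x|%N = 1%N}.
Proof.
move=> nb [le_sn /allP s0 _ [L [R [uL uR]]]].
rewrite circulant_ev -/(smith_mx _ s).
set ev := horner_mx _; set C := ev _ => defC x /[dup] xs /s0 x0.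
have [i lt_is xE] := nthP 0 xs.
pose o : 'I_n.+1 := Ordinal (leq_trans lt_is le_sn).
pose e : 'rV[int]_n.+1 := delta_mx 0 o.
have eD : e *m smith_mx n.+1 s = x *: e.
  by rewrite smith_mxE /e -rowE row_diag_mx !mxE /= -xE.
have : x *: (e *m R) = e *m invmx L *m C.
  by rewrite defC !mulmxA mulmxKV // eD scalemxAl.
rewrite [RHS]mulmx_ev -(row0_ev_rVpoly (x *: _)) => /row0_ev_inj [h].
have [q] := Phi6_dvd b; rewrite -nb linearZ /= => ->; rewrite mulrA -mulrDl.
case/(Phi6_sat x0)=> g eRE.
have eR : e *m R = row 0 (ev g) *m C.
  by rewrite row0_evM -eRE row0_ev_rVpoly.
have {eR} /matrixP /(_ 0 o) : e = row 0 (ev g) *m L *m smith_mx n.+1 s.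
  by rewrite -[LHS](mulmxK uR) eR defC !mulmxA mulmxK.
rewrite smith_mxE mul_mx_diag !mxE !eqxx /= xE => e1.
have : (x %| 1)%Z by apply/dvdzP; eexists; exact: e1.
by rewrite dvdz1 => /eqP.
Qed.

(** * Units modulo t^N - 1 *)

Lemma sum_sqr_eq1 n (u : 'rV[int]_n) : \sum_j u 0 j ^+ 2 = 1 ->
  exists (j : 'I_n) (e : bool), u = (-1) ^+ e *: delta_mx 0 j.
Proof.
move=> u1; have [j uj] : exists j, u 0 j != 0.
  apply/existsP; apply: contra_eqT u1; rewrite negb_exists => /forallP u0.
  by rewrite big1 // => j _; move/(_ j)/negbNE/eqP: u0 => ->; rewrite expr0n.
move: u1; rewrite (bigD1 j) //=; set S := \sum_(_ | _) _ => u1.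
have S0 : 0 <= S by apply: sumr_ge0 => k _; exact: sqr_ge0.
have [ujE SE] : u 0 j ^+ 2 = 1 /\ S = 0 by split; nia.
exists j, (u 0 j < 0); apply/rowP=> k; rewrite !mxE eqxx /=.
have [->|kj] := eqVneq k j.
  have: (u 0 j == 1) || (u 0 j == -1) by rewrite -sqrf_eq1 ujE.
  by case/orP=> /eqP ->; rewrite /= ?expr0 ?expr1 mulr1.
rewrite mulr0; apply/eqP; rewrite -sqrf_eq0; move/eqP: SE.
rewrite psumr_eq0 => [/allP/(_ k)|i _]; last exact: sqr_ge0.
by rewrite mem_index_enum kj; apply.
Qed.

Section UnitModCyclic.
Variable n : nat.
Local Notation N := n.+1.
Local Notation cyc := ('X^N - 1 : {poly int}).
Local Notation ev := (horner_mx (shift_mx n)).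

(* If u is a unit of Z[t]/(t^N - 1) and u* is its image under t -> t^-1, then
   the element u / u* has coefficients whose squares sum to 1. *)
Lemma unit_ev_tr (F g h : {poly int}) : g * F = 1 + h * cyc ->
  exists k (e : bool), ev F = ev ((-1) ^+ e *: 'X^k) *m (ev F)^T.
Proof.
move=> gF; have evgF : ev g *m ev F = 1%:M.
  by have := congr1 ev gF; rewrite rmorphM rmorphD /= ev_cyc addr0 rmorph1.
have evFg : ev F *m ev g = 1%:M by rewrite ev_comm.
(* [g] inverts [F] modulo t^N - 1, so [q] represents F / F*. *)
pose q := F * (g \Po 'X^n).
have evq : ev q = ev F *m (ev g)^T by rewrite rmorphM ev_tr.
have : ev q *m (ev q)^T = 1%:M.
  rewrite evq trmx_mul trmxK mulmxA -(mulmxA (ev F)) -ev_tr_comm mulmxA evFg.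
  by rewrite mul1mx -trmx_mul evFg trmx1.
(* The entry (0, 0) of this product is the sum of the squares of row 0 of [ev q]. *)
move/matrixP/(_ 0 0); rewrite !mxE eqxx /=.
under eq_bigr do rewrite mxE -expr2.
move=> q1; have [|j [e qE]] := @sum_sqr_eq1 _ (row 0 (ev q)).
  by rewrite -[RHS]q1; apply: eq_bigr => j _; rewrite mxE.
exists j, e.
have /row0_ev_inj [h' ->] :
    row 0 (ev ((-1) ^+ e *: 'X^j)) = row 0 (ev q).
  rewrite qE linearZ /= linearZ /=; congr (_ *: _).
  by rewrite -(rVpoly_delta) row0_ev_rVpoly.
by rewrite rmorphD /= ev_cyc addr0 evq -mulmxA -trmx_mul evFg trmx1 mulmx1.
Qed.

(** With * for t -> t^-1, Phi = t^2 Phi* and F = +-t^k F* give f = +-t^(k+2) f* modulo t^N - 1; then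
    coefficients are compared. The bound on n keeps 0, 1 and 2 distinct modulo N. *)
Lemma fpoly_unit_mod m (F g h : {poly int}) :
    (2 <= n)%N -> fpoly m = F * Phi6 -> g * F = 1 + h * cyc ->
  m = 1 %[mod n.+1] \/ m = 2 %[mod n.+1].
Proof.
move=> n2 fE /unit_ev_tr [k [e evF]].
(* x2 is kept opaque because rmorphM would unfold 'X^2 into a product. *)
have [x2 x2E evPhi] : exists2 x2 : {poly int}, x2 = 'X^2 &
    ev Phi6 = ev x2 *m (ev Phi6)^T.
  exists 'X^2 => //.
  rewrite ev_tr mulmxE -rmorphM.
  suff -> : 'X^2 * (Phi6 \Po 'X^n) = Phi6 + ('X^N + 1 - 'X) * ('X^N - 1).
    by rewrite [RHS]rmorphD /= ev_cyc addr0.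
  rewrite rmorphD rmorphB rmorphXn rmorph1 /= comp_polyX.
  by rewrite (exprS 'X n); ring.
pose r : {poly int} := (-1) ^+ e *: ('X^(k.+2) * (fpoly m \Po 'X^n)).
have evf : ev (fpoly m) = ev r.
  have -> : r = ((-1) ^+ e *: 'X^k) * x2 * (fpoly m \Po 'X^n).
    by rewrite x2E -!scalerAl -exprD addn2.
  rewrite fE comp_polyM !rmorphM /= -!mulmxE -!ev_tr {1}evF {1}evPhi.
  by rewrite -!mulmxA [X in _ *m X]mulmxA -ev_tr_comm -!mulmxA.
have rE : r = (-1) ^+ e *: ('X^(k.+2 + n * m) - 'X^(k.+2 + n) + 'X^(k.+2)).
  rewrite /r rmorphD rmorphB /= rmorphXn rmorph1 /= comp_polyX -exprM.
  by rewrite mulrDr mulrBr mulr1 -!exprD.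
(* Evaluation at 1, a root of t^N - 1, gives 1 on the left and (-1)^e on the right. *)
have e0 : e = false.
  have [h' /(congr1 (horner^~ 1))] := row0_ev_inj (congr1 (row 0) evf).
  rewrite rE /= !hornerE !expr1n !subrr add0r mulr1 mulr0 addr0 => /eqP.
  by case: (e).
have evX i j : ev 'X^i 0 j = (val j == i %% N)%N%:R.
  by rewrite rmorphXn /= horner_mx_X shift_mxXE -val_eqE.
(* Coefficient j of f = t^(k+2) f*, exponents taken modulo N, with n in place of -1. *)
have coefE (j : 'I_N) : (val j == m %% N)%N%:R - (val j == 1 %% N)%N%:R
    + (val j == 0 %% N)%N%:R = (val j == (k.+2 + n * m) %% N)%N%:R
    - (val j == (k.+2 + n) %% N)%N%:R + (val j == k.+2 %% N)%N%:R :> int.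
  rewrite -!evX; have /matrixP/(_ 0 j) := evf.
  rewrite rE e0 expr0 scale1r !rmorphD !rmorphN /=.
  have addE (A B : 'M[int]_N) : (A + B) 0 j = A 0 j + B 0 j by rewrite mxE.
  have oppE (A : 'M[int]_N) : (- A) 0 j = - A 0 j by rewrite mxE.
  by rewrite !addE !oppE.
(* If m is not 1 mod N, the coefficients of t and then of t^2 give k + 2 = 2 and
   then m = 2 modulo N. *)
have n1 : (1 < N)%N by lia.
have n2N : (2 < N)%N by lia.
have := coefE (Ordinal n2N); have := coefE (Ordinal n1).
rewrite mod0n (modn_small n1) (modn_small n2N) /=.
rewrite [(1 == m %% _)%N]eq_sym [(2 == m %% _)%N]eq_sym.
have [|m1] := eqVneq (m %% N)%N 1%N; first by left.
have [|m2] := eqVneq (m %% N)%N 2%N; first by right.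
have cE : (1%N == ((k.+2 + n) %% N)%N) -> (2%N == (k.+2 %% N)%N).
  move/eqP=> b1; apply/eqP; rewrite -(modnDr k.+2 N).
  have -> : (k.+2 + N = k.+2 + n + 1)%N by rewrite addn1 addnS.
  by rewrite -modnDml -b1 modn_small.
case: (boolP (1%N == ((k.+2 + n) %% N)%N)) cE => [/eqP <- /(_ isT) ->|_ _].
  by case: eqP => // _; case: eqP => // _; case: eqP.
by case: eqP => // _; case: eqP.
Qed.

End UnitModCyclic.

(** * Divisibility by Phi and arithmetic of the exponents *)

Lemma fpoly_Phi6 m : m = 2 %[mod 6] -> exists F, fpoly m = F * Phi6.
Proof.
move=> m2; rewrite (divn_eq m 6) m2 mulnC.
(* With m = 6a + 2, f = t^2 (t^(6a) - 1) + Phi. *)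
have [q qE] := Phi6_dvd (m %/ 6); exists ('X^2 * q + 1).
by rewrite mulrDl mul1r -mulrA -qE exprD; ring.
Qed.

(** The cofactor t^(2d) + t^d + 1 of t^d - 1 is z^(2e) + z^e + 1 with z = t^2 and d = 2e. As 3 does
    not divide e, it is a multiple of z^2 + z + 1 = (t^2 + t + 1) Phi. *)
Lemma Phi6_cyc_quotient d : ~~ odd d -> ~~ (3 %| d)%N ->
  exists Q : {poly int}, 'X^(3 * d) - 1 = Q * ('X^d - 1) * Phi6.
Proof.
move=> d2 d3; pose z : {poly int} := 'X^2; pose s := z ^+ 2 + z + 1.
have sE : s = ('X^2 + 'X + 1) * Phi6 by rewrite /s /z; ring.
suff [u uE] : exists u, ('X^d) ^+ 2 + 'X^d + 1 = u * s.
  exists (u * ('X^2 + 'X + 1)); rewrite mulnC exprM.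
  rewrite mulrAC -[u * _ * Phi6]mulrA -sE -uE; ring.
have [e dE] : exists e, d = (2 * e)%N.
  by exists (d./2); rewrite mul2n even_halfK.
have [q qE] := subX1_dvd z 3 (e %/ 3).
have [e1|e2] : (e %% 3 = 1)%N \/ (e %% 3 = 2)%N.
  by move: d3; rewrite dE Euclid_dvdM //= /dvdn; lia.
- rewrite dE exprM -/z (divn_eq e 3) e1 mulnC exprD.
  rewrite -(subrK 1 (z ^+ (3 * _))) qE.
  (* Here z^e = z + w s, and in the other case z^e = z^2 + w s; expanding gives the witnesses. *)
  pose w := q * (z - 1) * z; exists (1 + 2 * z * w + w ^+ 2 * s + w).
  by rewrite /w /s; ring.
- rewrite dE exprM -/z (divn_eq e 3) e2 mulnC exprD.
  rewrite -(subrK 1 (z ^+ (3 * _))) qE.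
  pose w := q * (z - 1) * z ^+ 2.
  exists (z ^+ 2 - z + 1 + 2 * z ^+ 2 * w + w ^+ 2 * s + w).
  by rewrite /w /s; ring.
Qed.

Lemma fpoly_Phi6_eq2 d m (g h : {poly int}) :
    ~~ odd d -> ~~ (3 %| d)%N -> (2 <= m < 3 * d)%N -> m = 2 %[mod 6] ->
  Phi6 = g * fpoly m + h * ('X^(3 * d) - 1) -> m = 2%N.
Proof.
move=> d2 d3 /andP[m_ge2 m_lt] m6; have [F fE] := fpoly_Phi6 m6.
have [Q ->] := Phi6_cyc_quotient d2 d3; rewrite fE => gh.
(* The unit argument needs d >= 3; for d = 2, the bounds 2 <= m < 6 and m = 2 mod 6 already force m
   = 2. *)
case: d => [|[|[|d]]] in d2 d3 m_lt gh *; [by [] | by [] | by lia |].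
have gF : g * F = 1 + (- h * Q) * ('X^(d.+3) - 1).
  apply: (mulIf (monic_neq0 Phi6_monic)).
  by rewrite [in RHS]mulrDl mul1r {2}gh; ring.
have [|m1|md] := fpoly_unit_mod _ fE gF; first by [].
  have := odd_mod m (negPf d2); rewrite m1 odd_mod ?(negPf d2) //.
  by have := odd_mod m (erefl (odd 6)); rewrite m6 => <-.
have : (3 * d.+3 %| m - 2)%N.
  rewrite Gauss_dvd ?prime_coprime // -!eqn_mod_dvd // md eqxx andbT.
  by apply/eqP; lia.
rewrite /dvdn modn_small; lia.
Qed.

(** * Abelianisations of presented groups *)

(* Maps that are additive modulo a subgroup S stand for homomorphisms into
   V / S, which spares the construction of the quotient. *)
Section MorphismModulo.
Local Open Scope quotient_scope.
Variables (V : zmodType) (S : V -> Prop).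
Hypotheses (S0 : S 0) (SB : forall u v, S u -> S v -> S (u - v)).

Definition morph_mod (G : groupType) (e : G -> V) :=
  forall x y : G, S (e (x * y)%g - (e x + e y)).

Lemma modN u : S u -> S (- u).
Proof. by rewrite -[- u]add0r; exact: SB. Qed.

Lemma modD u v : S u -> S v -> S (u + v).
Proof. by move=> Su /modN Sv; rewrite -[v]opprK; exact: SB. Qed.

Lemma mod_refl u : S (u - u).
Proof. by rewrite subrr; exact: S0. Qed.

Lemma mod_trans v u w : S (u - v) -> S (v - w) -> S (u - w).
Proof. by move=> uv vw; have := modD uv vw; rewrite addrA subrK. Qed.

Lemma mod_sym u v : S (u - v) -> S (v - u).
Proof. by move=> /modN; rewrite opprB. Qed.

Lemma mod_add u u' v v' : S (u - u') -> S (v - v') -> S (u + v - (u' + v')).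
Proof. by move=> uu vv; rewrite opprD addrACA; exact: modD. Qed.

Section OneGroup.
Variables (G : groupType) (e : G -> V).
Hypothesis eM : morph_mod e.

Lemma morph_mod1 : S (e 1%g - 0).
Proof. by have /modN := eM 1%g 1%g; rewrite mulg1 opprB addrK subr0. Qed.

Lemma morph_modV x : S (e x^-1%g - - e x).
Proof.
have := mod_trans (mod_sym (eM x^-1%g x)) _; rewrite mulVg => /(_ _ morph_mod1).
by rewrite subr0 opprK.
Qed.

Lemma morph_modJ x y : S (e (x ^ y)%g - e x).
Proof.
rewrite /conjg; apply: mod_trans (eM _ _) _; rewrite -[e x](addKr (e y)).
apply: mod_add; first exact: morph_modV.
by rewrite [e y + _]addrC; exact: eM.
Qed.

Lemma morph_modR x y : S (e [~ x, y]%g).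
Proof.
rewrite -[e _]subr0 /commg; apply: mod_trans (eM _ _) _.
rewrite -[0](addNr (e x)).
by apply: mod_add; [exact: morph_modV | exact: morph_modJ].
Qed.

(** The elements that [e] sends into [S] form a normal subgroup, since conjugation has no effect in
    a commutative target. *)
Lemma morph_mod_closure (R : G -> Prop) : (forall x, R x -> S (e x)) ->
  forall x, normal_closure R x -> S (e x).
Proof.
move=> RS x; elim=> {x} [|x /RS //|x y _ Sx _ Sy|x _ Sx|x y _ Sx].
- by rewrite -[e _]subr0; exact: morph_mod1.
- by rewrite -[e _](subrK (e x + e y)); apply/modD/modD.
- rewrite -[e _](addrK (e x)) -{1}[e x]opprK.
  by apply: SB; [exact: morph_modV|].
- by rewrite -[e _](subrK (e x)); apply: modD Sx; exact: morph_modJ.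
Qed.

Variable R : G -> Prop.
Hypothesis RS : forall x, R x -> S (e x).

(** [repr] is not a morphism, but the representative it picks differs from x by an element of the
    closure, which [e] sends into [S]. *)
Lemma quotient_morph_mod_pi x : S (e (repr (\pi_(quotient_group R) x)) - e x).
Proof.
have /(morph_mod_closure RS) := quotient_reprP R x; set y := repr _ => Syx.
have e_yx : S (e (y^-1 * x)%g - (- e y + e x)).
  exact: mod_trans (eM _ _) (mod_add (morph_modV y) (mod_refl _)).
by have := SB Syx e_yx; rewrite opprB addrC subrK addrC => /mod_sym.
Qed.

Lemma quotient_morph_mod : morph_mod (fun a : quotient_group R => e (repr a)).
Proof.
move=> a b; apply: mod_trans (eM _ _); rewrite -{1}[a]reprK -{1}[b]reprK.
have -> : (\pi_(quotient_group R) (repr a) * \pi_(quotient_group R) (repr b))%g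
    = \pi_(quotient_group R) (repr a * repr b)%g by exact: quotient_mulE.
exact: quotient_morph_mod_pi.
Qed.

End OneGroup.
End MorphismModulo.

(** * Evaluation of free groups in abelian groups *)

Section FreeEval.
Local Open Scope quotient_scope.
Variables (X : choiceType) (V : zmodType) (v : X -> V).

Definition word_eval (w : word X) : V :=
  \sum_(l <- w) (if l.2 then v l.1 else - v l.1).

Lemma word_eval_cat u w : word_eval (u ++ w) = word_eval u + word_eval w.
Proof. exact: big_cat. Qed.

Lemma word_eval_eq u w : free_eq u w -> word_eval u = word_eval w.
Proof.
elim=> {u w} // [u w x b|u w t _ -> _ -> //].
rewrite !word_eval_cat /word_eval !big_cons /=; congr (_ + _); rewrite addrA.
by case: b; rewrite /= ?subrr ?addNr add0r.
Qed.

Definition free_eval (a : free_group X) : V := word_eval (repr a).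

Lemma free_eval_pi w : free_eval (\pi_(free_group X) w) = word_eval w.
Proof. exact/word_eval_eq/free_reprP. Qed.

Lemma free_evalM a b : free_eval (a * b)%g = free_eval a + free_eval b.
Proof. by rewrite free_eval_pi word_eval_cat. Qed.

Lemma free_eval_gen x : free_eval (free_gen x) = v x.
Proof. by rewrite free_eval_pi /word_eval big_seq1. Qed.

Lemma free_evalV a : free_eval a^-1%g = - free_eval a.
Proof.
apply/eqP; rewrite -subr_eq0 opprK -free_evalM mulVg.
by rewrite free_eval_pi /word_eval big_nil.
Qed.

End FreeEval.

Section Abelianisation.
Local Open Scope quotient_scope.
Variables (X : choiceType) (R : free_group X -> Prop).
Local Notation G := (presented_group R).
Local Notation commutators := (fun z : G => exists x y : G, z = [~ x, y]%g).

Definition ab : Type := abelianisation G.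
HB.instance Definition _ := Choice.on ab.

Definition ab_pi (x : free_group X) : ab :=
  \pi_(quotient_group commutators) (\pi_(quotient_group R) x).

Lemma ab_ind (P : ab -> Prop) : (forall x, P (ab_pi x)) -> forall a, P a.
Proof.
move=> Ppi; elim/quotW=> a; rewrite -[a](@reprK _ (quotient_group R)).
exact: Ppi.
Qed.

Definition ab_add (a b : ab) : ab := ((a : abelianisation G) * b)%g.
Definition ab_opp (a : ab) : ab := ((a : abelianisation G)^-1)%g.
Definition ab_zero : ab := (1 : abelianisation G)%g.

Lemma ab_piM x y : ab_pi (x * y)%g = ab_add (ab_pi x) (ab_pi y).
Proof.
rewrite /ab_add; apply/esym/(etrans (quotient_mulE _ _ _)).
by congr (\pi_(quotient_group commutators) _); exact: quotient_mulE.
Qed.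

Lemma ab_piV x : ab_pi (x^-1)%g = ab_opp (ab_pi x).
Proof.
rewrite /ab_opp; apply/esym/(etrans (quotient_invE _ _)).
by congr (\pi_(quotient_group commutators) _); exact: quotient_invE.
Qed.

Lemma ab_addC : commutative ab_add.
Proof.
elim/quotW=> a; elim/quotW=> b.
apply: etrans (quotient_mulE _ _ _) _.
apply: etrans (esym (quotient_mulE _ _ _)).
apply/quotient_piP/normal_closure_gen; exists b, a.
by rewrite /commg /conjg invgM -!mulgA.
Qed.

Fact ab_addA : associative ab_add. Proof. exact: mulgA. Qed.
Fact ab_add0 : left_id ab_zero ab_add. Proof. exact: mul1g. Qed.
Fact ab_addN : left_inverse ab_zero ab_opp ab_add. Proof. exact: mulVg. Qed.

HB.instance Definition _ :=
  GRing.isZmodule.Build ab ab_addA ab_addC ab_add0 ab_addN.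

Definition ab_gen (x : X) : ab := ab_pi (free_gen x).

Lemma ab_pi0 x : R x -> ab_pi x = 0.
Proof.
move=> Rx; congr (\pi_(quotient_group commutators) _).
by apply/quotient_piP; rewrite mulg1; apply/normal_closureV/normal_closure_gen.
Qed.

Lemma ab_gen_ind (P : ab -> Prop) :
  P 0 -> (forall a b, P a -> P b -> P (a - b)) -> (forall x, P (ab_gen x)) ->
  forall a, P a.
Proof.
move=> P0 PB Pgen; elim/ab_ind; elim/quotW; elim=> [|[x b] w Pw].
  exact: P0.
have PN a : P a -> P (- a) by rewrite -[- a]add0r; exact: PB.
have PD a c : P a -> P c -> P (a + c).
  by move=> Pa /PN Pc; rewrite -[c]opprK; exact: PB.
have -> : \pi_(free_group X) ((x, b) :: w : word X)
    = (\pi_(free_group X) ([:: (x, b)] : word X) * \pi_(free_group X) w)%g.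
  exact/esym/free_mulE.
rewrite ab_piM; apply: PD Pw; case: b; first exact: Pgen.
rewrite -[\pi _](free_invE [:: (x, true)] : (free_gen x)^-1%g = _) ab_piV.
exact/PN/Pgen.
Qed.

(** The universal property of an abelianised presentation: [v] descends through the relators, then
    through the commutators, which fall into [S] by [morph_modR]. *)
Lemma ab_eval (V : zmodType) (S : V -> Prop) (v : X -> V) :
    S 0 -> (forall u w, S u -> S w -> S (u - w)) ->
    (forall r, R r -> S (free_eval v r)) ->
  exists2 e : abelianisation G -> V, morph_mod S e &
    forall x, S (e (ab_gen x) - v x).
Proof.
move=> S0 SB RS.
have e0M : morph_mod S (@free_eval X V v).
  by move=> x y; rewrite free_evalM subrr.
have e1M := quotient_morph_mod S0 SB e0M RS.
have cS r : commutators r -> S (free_eval v (repr r)).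
  by case=> x [y ->]; exact: (morph_modR S0 SB e1M).
exists (fun a => free_eval v (repr (repr a))).
  exact: (quotient_morph_mod S0 SB e1M cS).
move=> x; rewrite -(free_eval_gen v x).
apply: mod_trans (quotient_morph_mod_pi S0 SB e1M cS _) _ => //.
exact: (quotient_morph_mod_pi S0 SB e0M RS).
Qed.

End Abelianisation.

(** * Gilbert-Howie groups *)

Lemma row_int_ind n (P : 'rV[int]_n -> Prop) :
    P 0 -> (forall u v, P u -> P v -> P (u - v)) ->
    (forall i, P (delta_mx 0 i)) -> forall v, P v.
Proof.
move=> P0 PB Pdelta v; rewrite [v]row_sum_delta.
have PD a c : P a -> P c -> P (a + c).
  by move=> Pa Pc; rewrite -[c]opprK -[- c]add0r; apply/PB/PB.
apply: (big_ind P) => // i _.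
elim/int_ind: (v 0 i) => [|k Pk|k Pk].
- by rewrite scale0r.
- by rewrite intS scalerDl scale1r; exact: PD.
- by rewrite intS opprD scalerDl scaleN1r addrC; apply: PB.
Qed.

Section GilbertHowie.
Variables n m : nat.
Local Notation N := n.+1.
Local Notation C := (circulant N (fpoly m)).
Local Notation A := (ab (@gilbert_howie_relator N m)).

Definition gh_gen (i : 'I_N) : A := ab_gen _ i.

Definition gh_row (v : 'rV[int]_N) : A := \sum_i gh_gen i *~ v 0 i.

Lemma gh_rowB u v : gh_row (u - v) = gh_row u - gh_row v.
Proof.
rewrite /gh_row -sumrB; apply: eq_bigr => i _.
by rewrite !mxE mulrzBr.
Qed.

Lemma gh_row0 : gh_row 0 = 0.
Proof. by rewrite -[0]subr0 gh_rowB subrr. Qed.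

Lemma gh_rowN u : gh_row (- u) = - gh_row u.
Proof. by rewrite -[- u]add0r gh_rowB gh_row0 add0r. Qed.

Lemma gh_rowD u v : gh_row (u + v) = gh_row u + gh_row v.
Proof. by rewrite -{1}[v]opprK gh_rowB gh_rowN opprK. Qed.

Lemma gh_rowZ c u : gh_row (c *: u) = gh_row u *~ c.
Proof.
by rewrite /gh_row mulrz_suml; apply: eq_bigr => i _; rewrite mxE mulrC mulrzA.
Qed.

Lemma gh_row_delta i : gh_row (delta_mx 0 i) = gh_gen i.
Proof.
rewrite /gh_row (bigD1 i) //= big1 => [|j ji]; rewrite !mxE ?eqxx ?addr0 //.
by rewrite (negPf ji).
Qed.

(** Row i is the exponent vector of the relator of index i. *)
Lemma row_circulant i :
  row i C =
  delta_mx 0 (ord_shift i m) - delta_mx 0 (ord_shift i 1) + delta_mx 0 i.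
Proof.
rewrite circulant_ev rmorphD rmorphB rmorphXn /= horner_mx_X rmorph1.
have rowX k : row i (shift_mx n ^+ k) = delta_mx 0 (ord_shift i k).
  by apply/rowP=> j; rewrite mxE shift_mxXE !mxE.
have := rowX 1%N; rewrite expr1 => rowP.
by rewrite linearD linearB /= rowX rowP -[X in _ = _ + X]row1.
Qed.

Lemma gh_row_circulant y : gh_row (y *m C) = 0.
Proof.
elim/row_int_ind: y => [|u v hu hv|i]; first by rewrite mul0mx gh_row0.
  by rewrite mulmxBl gh_rowB hu hv subrr.
rewrite -rowE row_circulant gh_rowD gh_rowB !gh_row_delta.
have /ab_pi0 : @gilbert_howie_relator N m
    (free_gen i * free_gen (ord_shift i m) * (free_gen (ord_shift i 1))^-1)%g.
  by exists i.
rewrite !ab_piM ab_piV => e; rewrite addrC addrA; exact: e.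
Qed.

Lemma gh_row_surj a : exists v, a = gh_row v.
Proof.
elim/ab_gen_ind: a => [|a c [u ->] [v ->]|i].
- by exists 0; rewrite gh_row0.
- by exists (u - v); rewrite gh_rowB.
- by exists (delta_mx 0 i); rewrite gh_row_delta.
Qed.

(** Additive maps sending the rows of [C] into [S] factor through [A]. Taking for f the identity and
    for [S] the row lattice of [C] shows that [gh_row] kills nothing outside that lattice. *)
Lemma gh_eval (V : zmodType) (S : V -> Prop) (f : 'rV[int]_N -> V) :
    S 0 -> (forall u w, S u -> S w -> S (u - w)) ->
    {morph f : u v / u - v} -> (forall i, S (f (row i C))) ->
  exists2 e : A -> V, @morph_mod V S (abelianisation (gilbert_howie N m)) e &
    forall v, S (e (gh_row v) - f v).
Proof.
move=> S0 SB fB fS; have f0 : f 0 = 0 by rewrite -[0]subr0 fB subrr.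
have fN u : f (- u) = - f u by rewrite -[- u]add0r fB f0 add0r.
have fD u v : f (u + v) = f u + f v by rewrite -{1}[v]opprK fB fN opprK.
have [|e eM e_gen] := @ab_eval _ (@gilbert_howie_relator N m) V S
    (fun i => f (delta_mx 0 i)) S0 SB.
  move=> _ [i ->]; rewrite !free_evalM free_evalV !free_eval_gen.
  by have := fS i; rewrite row_circulant fD fB addrC addrA.
exists e => //; elim/row_int_ind => [|u v hu hv|i].
- by rewrite gh_row0 f0; exact: (morph_mod1 S0 SB eM).
- rewrite gh_rowB fB; apply: (mod_trans S0 SB (eM _ _)).
  apply: (mod_add S0 SB hu); apply: (mod_trans S0 SB (morph_modV S0 SB eM _)).
  by rewrite -opprD; exact: (modN S0 SB hv).
- by rewrite gh_row_delta.
Qed.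

(** The abelianisation is Z[t]/(f, t^N - 1), and the class of p there is killed by c; in Z^2 this
    makes it zero. *)
Lemma gh_ab_torsionfree (c : int) (p g h : {poly int}) : c != 0 ->
    isomorphic_to_additive (abelianisation (gilbert_howie N m))
      (int * int)%type ->
    c *: p = g * fpoly m + h * ('X^N - 1) ->
  exists g' h' : {poly int}, p = g' * fpoly m + h' * ('X^N - 1).
Proof.
move=> c0 [phi [[psi psiK _] phiM]] cp.
have phi1 : phi 1%g = 0.
  by apply: (addrI (phi 1%g)); rewrite addr0 -phiM mulg1.
have phiB : {morph (phi : A -> (int * int)%type) : a b / a - b}.
  move=> a b; apply: (addIr (phi b)); rewrite subrK.
  by apply: etrans (esym (phiM _ _)) _; congr phi; exact: (subrK (b : A)).
pose Phi : {additive A -> (int * int)%type} :=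
  HB.pack (phi : A -> _) (GRing.isZmodMorphism.Build A _ phi phiB).
pose v := row 0 (horner_mx (shift_mx n) p).
have v0 : gh_row v = 0.
  have cv0 : gh_row v *~ c = 0.
    rewrite -gh_rowZ /v -linearZ /= -linearZ /= cp row0_ev_cyc -row0_evM.
    by rewrite -(circulant_ev n (fpoly m)) gh_row_circulant.
  apply: (can_inj psiK); rewrite phi1.
  have : Phi (gh_row v) *~ c = 0 by rewrite -raddfMz cv0 raddf0.
  have cancel_c (x : int) : x *~ c = 0 -> x = 0.
    by rewrite mulrzz => /eqP; rewrite mulf_eq0 (negPf c0) orbF => /eqP.
  move=> Phi_c; apply/eqP; rewrite -pair_eqE /=; apply/andP; split; apply/eqP.
    by apply: cancel_c; rewrite -(raddfMz fst) Phi_c.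
  by apply: cancel_c; rewrite -(raddfMz snd) Phi_c.
pose S (u : 'rV[int]_N) := exists y, u = y *m C.
have S0 : S 0 by exists 0; rewrite mul0mx.
have SB u w : S u -> S w -> S (u - w).
  by case=> [y ->] [z ->]; exists (y - z); rewrite mulmxBl.
have [//|i|e _ eE] := @gh_eval _ S id S0 SB.
  by exists (delta_mx 0 i); rewrite rowE.
have [y yE] : S (v - 0).
  apply: (mod_trans S0 SB (mod_sym S0 SB (eE v))).
  by rewrite v0 -gh_row0; exact: eE.
move: yE; rewrite subr0 /v circulant_ev mulmx_ev => /row0_ev_inj [h' ->].
by exists (rVpoly y), h'.
Qed.

End GilbertHowie.

(** The isomorphism reads the two coefficients of the remainder modulo Phi; its inverse sends (x, y)
    to the class of x + y t. *)
Lemma Phi6_ab_iso n b : n.+1 = (6 * b)%N ->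
  isomorphic_to_additive (abelianisation (gilbert_howie n.+1 2))
    (int * int)%type.
Proof.
move=> nb; pose C := circulant n.+1 Phi6.
pose f (v : 'rV[int]_n.+1) : (int * int)%type :=
  ((rVpoly v %% Phi6)`_0, (rVpoly v %% Phi6)`_1).
have uPhi : lead_coef Phi6 \is a GRing.unit by rewrite (eqP Phi6_monic) unitr1.
have fB : {morph f : u v / u - v}.
  move=> u v; rewrite /f linearB /= Pdiv.IdomainUnit.modpD //.
  by rewrite Pdiv.IdomainUnit.modpN // !coefB.
(* The row [y *m C] is a multiple of Phi reduced modulo t^N - 1, which Phi divides since 6 divides
   N. *)
have rVC y : exists k, rVpoly (y *m C) = k * Phi6.
  rewrite /C circulant_ev mulmx_ev ev_row0.
  have [q cycE] := Phi6_dvd b; rewrite poly_rV_K ?size_mod_cyc //.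
  set p := _ * Phi6; exists (rVpoly y - p %/ ('X^(n.+1) - 1) * q).
  rewrite mulrBl -mulrA -cycE -nb -/p; apply/eqP.
  by rewrite eq_sym subr_eq addrC -divp_eq ?cyc_monic.
have fC i : f (row i C) = 0.
  have [k] := rVC (delta_mx 0 i); rewrite -rowE /f => ->.
  by rewrite modp_mull !coef0.
have [//|_ _ -> ->|//|e eM eE] := @gh_eval n 2 _ (fun x => x = 0) f _ _ fB.
  by rewrite subrr.
have e_row v : e (gh_row 2 v) = f v by apply/eqP; rewrite -subr_eq0 eE.
have szPhi : size Phi6 = 3%N.
  rewrite -addrA size_polyDl size_polyXn //.
  rewrite (leq_ltn_trans (size_polyD _ _)) //.
  by rewrite size_polyN size_polyX size_poly1.
have f_ker w : f w = 0 -> gh_row 2 w = 0.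
  case=> r0 r1; have rw : rVpoly w %% Phi6 = 0.
    apply/polyP=> -[|[|i]]; rewrite ?r0 ?r1 ?coef0 // nth_default //.
    have := ltn_modpN0 (rVpoly w) (monic_neq0 Phi6_monic).
    by rewrite szPhi ltnS => /leq_trans; apply.
  rewrite -(row0_ev_rVpoly w) (divp_eq Phi6_monic (rVpoly w)) rw addr0.
  by rewrite -row0_evM -(circulant_ev n Phi6) gh_row_circulant.
have size_lin (x y : int) : (size (x%:P + y *: 'X)%R <= 2)%N.
  rewrite (leq_trans (size_polyD _ _)) // geq_max.
  rewrite (leq_trans (size_polyC_leq1 _)) //=.
  by rewrite (leq_trans (size_scale_leq _ _)) // size_polyX.
pose psi (x : int * int) :=
  gh_row 2 (poly_rV (x.1%:P + x.2 *: 'X) : 'rV[int]_n.+1).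
have psiK : cancel psi e.
  case=> x y; rewrite e_row /f poly_rV_K; last first.
    by apply: leq_trans (size_lin x y) _; lia.
  rewrite modp_small ?szPhi ?ltnS ?size_lin //.
  by rewrite !coefD !coefC !coefZ !coefX /= !mulr0 !addr0 add0r mulr1.
have e_inj : injective e.
  move=> a c; have [u ->] := gh_row_surj a; have [v ->] := gh_row_surj c.
  rewrite !e_row => uv; apply/eqP; rewrite -subr_eq0 -gh_rowB; apply/eqP/f_ker.
  by rewrite fB uv subrr.
exists e; split; first by exists psi => //; exact: inj_can_sym psiK e_inj.
by move=> x y; apply/eqP; rewrite -subr_eq0; apply/eqP/eM.
Qed.

Theorem corollary5p7 (n b m : nat)
    (hn : [\/ n = (6 * b)%N, n = (12 * b)%N | n = (24 * b)%N])
    (hb : (1 <= b)%N) (hgcd : gcdn b 6 = 1%N)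
    (hm : (2 <= m < n)%N) (hm6 : m = 2 %[mod 6]) :
  [/\ forall gamma : nat,
        is_last_determinantal_divisor
          (circulant n ('X^m - 'X + 1 : {poly int})) gamma ->
        (gamma = 1%N <-> m = 2%N),
      isomorphic_to_additive (abelianisation (gilbert_howie n m))
        (int * int)%type <-> m = 2%N &
      m = 2%N -> gilbert_howie n m = sieradski n].
Proof.
(* d = n / 3 is 2b, 4b or 8b, prime to 3 because b is. *)
have [d [d2 d3 nd]] : exists d, [/\ ~~ odd d, ~~ (3 %| d)%N & n = (3 * d)%N].
  have b3 : ~~ (3 %| b)%N.
    apply/negP=> b3; have : (3 %| gcdn b 6)%N by rewrite dvdn_gcd b3.
    by rewrite hgcd.
  case: hn => ->; [exists (2 * b)%N | exists (4 * b)%N | exists (8 * b)%N];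
    by split; rewrite ?Euclid_dvdM ?oddM // mulnA.
have [c nc] : exists c, n = (6 * c)%N by exists (d./2); rewrite nd; lia.
have Phi6_m (g h : {poly int}) : Phi6 = g * fpoly m + h * ('X^n - 1) -> m = 2%N.
  by rewrite nd; apply: fpoly_Phi6_eq2; rewrite -?nd.
case: n nd nc hm Phi6_m {hn} => [|n] nd nc hm Phi6_m; first by lia.
split=> [gamma [s sC ->]||->] //.
- split=> [s1|m2]; last first.
    rewrite m2 in sC; have s1 := Phi6_snf_unit nc sC.
    rewrite big_seq; apply: (big_ind (fun x => absz x = 1%N)) => // x y x1 y1.
    by rewrite abszM x1 y1.
  have [g [h gh]] := fpoly_snf_Phi6 sC; set c0 := \prod_(x <- s) x in s1 gh.
  (* The entries of [s] carry signs, so c0 is 1 or -1 and is its own inverse. *)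
  have cc : c0 * c0 = 1 by lia.
  apply: (Phi6_m (c0 *: g) (c0 *: h)).
  by rewrite -!scalerAl -scalerDr -gh scalerA cc scale1r.
split=> [iso|->]; last exact: Phi6_ab_iso nc.
(* Any Smith form supplies a multiplier, the product of its non-zero entries, which torsion-freeness
   removes. *)
have [s sC] := smith_normal_form_exists (circulant n.+1 (fpoly m)).
have [g [h gh]] := fpoly_snf_Phi6 sC.
have [|g' [h' ]] := gh_ab_torsionfree _ iso gh; last exact: Phi6_m.
case: sC => _ /allP s0 _ _; rewrite prodf_seq_neq0; apply/allP => x xs.
by rewrite s0.
Qed.
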